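(* Let $s_m^{(0)}\in\mathcal{X}$ for $m=1,\ldots,M$. Let $\tau\in(0,2/\beta)$ and let $\omega_1>0,\ldots,\omega_M>0$ be reals whose sum is $1$. Set $\delta=2-\tau\beta/2$. Let $(\rho^{(i)})_{i\in\mathbb{N}}$ be a sequence in $[0,\delta]$ such that $\sum_{i\in\mathbb{N}}\rho^{(i)}(\delta-\rho^{(i)})=+\infty$. Then the sequence $(x^{(i+\frac12)})_{i\in\mathbb{N}}$ defined, for $i=0,1,\ldots$, by $$\begin{aligned}x^{(i+\frac12)}&=\mathrm{prox}_{\tau f}\Big(\sum_{m=1}^M\omega_ms_m^{(i)}\Big),\\ s_m^{(i+1)}&=s_m^{(i)}+\rho^{(i)}\Big(\mathrm{prox}_{\frac{\tau}{\omega_m}g_m}\big(2x^{(i+\frac12)}-s_m^{(i)}-\tau\nabla h(x^{(i+\frac12)})\big)-x^{(i+\frac12)}\Big),\quad m=1,\ldots,M,\end{aligned}$$ converges weakly to a solution of the problem of minimizing $f(x)+\sum_{m=1}^Mg_m(x)+h(x)$ over $x\in\mathcal{X}$.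
   Context: $M\ge1$ is an integer and $\mathcal{X}$ is a real Hilbert space. $\Gamma_0(\mathcal{X})$ is the set of convex, proper, lower semicontinuous functions from $\mathcal{X}$ to $\mathbb{R}\cup\{+\infty\}$; for $\varphi\in\Gamma_0(\mathcal{X})$, $\mathrm{prox}_{\varphi}(x)=\operatorname{arg\,min}_{x'\in\mathcal{X}}(\varphi(x')+\frac12\|x'-x\|^2)$ and $\partial\varphi$ is the subdifferential. Here $f\in\Gamma_0(\mathcal{X})$, $g_m\in\Gamma_0(\mathcal{X})$ for $m=1,\ldots,M$, and $h:\mathcal{X}\to\mathbb{R}$ is convex and differentiable with $\beta$-Lipschitz continuous gradient for some real $\beta>0$. Standing assumption: there exists $x\in\mathcal{X}$ with $0\in\partial f(x)+\sum_{m=1}^M\partial g_m(x)+\nabla h(x)$. *)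

(* Defs.v *)
From HB Require Import structures.
From mathcomp Require Import all_boot all_order all_algebra.
From mathcomp Require Import all_classical all_reals all_analysis.
Import Order.TTheory GRing.Theory Num.Theory.
Import numFieldNormedType.Exports.

Set Implicit Arguments.
Unset Strict Implicit.
Unset Printing Implicit Defensive.

Local Open Scope classical_set_scope.
Local Open Scope ring_scope.

HB.mixin Record NormedModule_isInner (R : realType) X of NormedModule R X := {
  inner : {dot X for (@idfun R)} ;
  inner_normE : forall x : X, inner x x = `|x| ^+ 2
}.

#[short(type="hilbertType")]
HB.structure Definition Hilbert (R : realType) :=
  {X of NormedModule_isInner R X & CompleteNormedModule R X}.

Section HilbertNotions.
Context {R : realType} {X : hilbertType R}.
Implicit Types (x y u : X) (phi : X -> \bar R) (h : X -> R).

(* For functions that never take the value -oo; the restriction to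
   0 < t < 1 avoids the convention for 0 * +oo. *)
Definition ereal_convex phi := forall x y (t : R), 0 < t < 1 ->
  (phi (t *: x + (1 - t) *: y)%R
     <= t%:E * phi x + (1 - t)%:E * phi y)%E.

Definition Gamma0 phi :=
  [/\ ereal_convex phi,
      (forall x, phi x != -oo%E) /\ (exists x, phi x != +oo%E)
    & lower_semicontinuous phi].

Definition argmin phi : set X :=
  [set p | forall y, (phi p <= phi y)%E].

(* For phi in Gamma0 this argmin is a singleton; 0 is a dummy default. *)
Definition prox phi x : X :=
  xget 0 (argmin (fun y => phi y + (2^-1 * `|y - x| ^+ 2)%:E)%E).

Definition subdiff phi x : set X :=
  [set u | forall y, (phi x + (inner u (y - x))%:E <= phi y)%E].

(* Riesz representative of the Frechet differential, which exists and is
   unique wherever h is differentiable; 0 is a dummy default. *)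
Definition grad h x : X :=
  xget 0 [set u | forall v : X, 'd h x v = inner u v].

Definition weakly_cvg (u : nat -> X) x :=
  forall y, (inner (u i) y @[i --> \oo] --> inner x y).

End HilbertNotions.

(* Main.v *)
Require Import Defs.
From mathcomp Require Import all_boot all_order all_algebra.
From mathcomp Require Import all_classical all_reals all_analysis.
From mathcomp Require Import ring lra.
Import Order.TTheory GRing.Theory Num.Theory.
Import numFieldNormedType.Exports.
Local Open Scope classical_set_scope.
Local Open Scope ring_scope.

(** The scheme is a relaxed iteration of an averaged operator on the product
    space of the families [s_m], with the weighted inner product
    [wdot s t = \sum_m omega_m <s_m, t_m>]; the point [x] returned at
    a fixed state is a minimizer.
    One evaluation at a state [s] returns [x = prox_(tau f) (avg s)] and
    [y_m = prox_(tau / omega_m g_m) (2 x - s_m - tau grad h x)], and the step is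
    [s_m + rho (y_m - x)].

    Averagedness.  Monotonicity of the subdifferentials of [f] and of the [g_m], and
    cocoercivity of [grad h] (the Baillon-Haddad theorem), give for two states
      [2 wdot (s - t) (r - r') + delta * wdot (r - r') (r - r') <= 0],
    where [r_m = y_m - x] is the residual ([residual_cocoercive]).  Applied to
    consecutive iterates it makes the norm of the residual nonincreasing; applied to
    an iterate and a fixed state it makes the squared distance to that state drop by
    [rho (delta - rho) wdot r r].  As the weights [rho (delta - rho)] have infinite
    sum, the residual tends to 0 ([residual_cvg0]).

    From the residual to [x].  A weak limit of [s] does not pass through the
    nonlinear prox, so the weak convergence of [x] is not immediate.  But the
    monotonicity defects of [f], of the [g_m] and of [grad h] between the iterates
    and a fixed state are nonnegative and have a weighted sum which pairs the
    residual with bounded sequences ([defect_sum]); hence they all tend to 0, and in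
    particular [grad h] converges strongly along the iterates.  Once the defects
    vanish, Minty's trick ([minty_wlim_gap]) bounds, for each function, the squared
    distance between the limiting point and a resolvent of the limiting pair; the
    weighted sum of these bounds is 0, so every weak limit of the iterates is a fixed state
    ([ultra_limit_fixed]).

    Uniqueness of the limit is Opial's argument ([opial_unique]): the distances to
    all fixed states converge, so two weak limits coincide.

    Limits are taken along ultrafilters finer than the Frechet filter rather than
    along subsequences: along an ultrafilter every bounded sequence converges weakly,
    by compactness of real segments and Riesz representation, and a real sequence
    converges as soon as it has the same limit along all these ultrafilters. *)

Set Implicit Arguments.
Unset Strict Implicit.
Unset Printing Implicit Defensive.

(** * Two facts about real numbers *)

Lemma le0_vanishing {R : realType} (a b : R) :
  0 <= b -> (forall t, 0 < t < 1 -> a <= b * t) -> a <= 0.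
Proof.
move=> b0 H; rewrite leNgt; apply/negP => a0.
have ab : 0 < 2 * (a + b) by lra.
have := H (a / (2 * (a + b))); rewrite divr_gt0 //= ltr_pdivrMr // mul1r.
have -> : a < 2 * (a + b) by lra.
move=> /(_ isT); rewrite mulrA ler_pdivlMr //.
by have := mulr_gt0 a0 a0; have := mulr_ge0 (ltW a0) b0; lra.
Qed.

Lemma cvg0_scale {R : realType} (c : R) (a b : nat -> R) : 0 < c -> (forall i, 0 <= a i) ->
  (forall i, c * a i <= b i) -> b i @[i --> \oo] --> 0 -> a i @[i --> \oo] --> 0.
Proof.
move=> c0 a0 ab b0.
apply: (@squeeze_cvgr _ _ _ _ (fun=> 0) (fun i => c^-1 * b i)).
- by apply: nearW => i; rewrite a0 /= mulrC ler_pdivlMr // mulrC.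
- exact: cvg_cst.
- by rewrite -[X in _ --> X](mulr0 c^-1); apply: cvgMl_tmp.
Qed.

(** * The inner product *)

Section Inner.
Context {R : realType} {X : hilbertType R}.
Implicit Types x y z : X.

Lemma innerC x y : inner x y = inner y x.
Proof. by rewrite (hermC inner) /= expr0 mul1r. Qed.
Lemma innerDl x y z : inner (x + y) z = inner x z + inner y z.
Proof. exact: linearDl. Qed.
Lemma innerDr x y z : inner z (x + y) = inner z x + inner z y.
Proof. exact: linearDr. Qed.
Lemma innerNl x z : inner (- x) z = - inner x z.
Proof. exact: linearNl. Qed.
Lemma innerNr x z : inner z (- x) = - inner z x.
Proof. exact: linearNr. Qed.
Lemma innerBl x y z : inner (x - y) z = inner x z - inner y z.
Proof. exact: linearBl. Qed.
Lemma innerBr x y z : inner z (x - y) = inner z x - inner z y.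
Proof. exact: linearBr. Qed.
Lemma innerZl a x z : inner (a *: x) z = a * inner x z.
Proof. exact: linearZl_LR. Qed.
Lemma innerZr a x z : inner z (a *: x) = a * inner z x.
Proof. by rewrite innerC innerZl innerC. Qed.
Lemma inner0l z : inner 0 z = 0.
Proof. exact: linear0l. Qed.
Lemma inner0r z : inner z 0 = 0.
Proof. exact: linear0r. Qed.
Lemma inner_ge0 x : 0 <= inner x x.
Proof. by rewrite inner_normE exprn_ge0. Qed.
Lemma inner_eq0 x : inner x x <= 0 -> x = 0.
Proof.
rewrite inner_normE => h; apply/eqP; rewrite -normr_eq0 -sqrf_eq0.
by rewrite eq_le h exprn_ge0.
Qed.
Lemma inner_suml I (r : seq I) (P : pred I) (F : I -> X) z :
  inner (\sum_(i <- r | P i) F i) z = \sum_(i <- r | P i) inner (F i) z.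
Proof. exact: linear_sumlz. Qed.
Lemma inner_sumr I (r : seq I) (P : pred I) (F : I -> X) z :
  inner z (\sum_(i <- r | P i) F i) = \sum_(i <- r | P i) inner z (F i).
Proof. exact: linear_sumr. Qed.

Definition innerE := (innerDl, innerDr, innerNl, innerNr, innerZl, innerZr).

(** The free constant lets each use choose how to balance the two squares. *)
Lemma young (c : R) x y : 2 * c * inner x y <= c ^+ 2 * inner x x + inner y y.
Proof.
have := inner_ge0 (c *: x - y); rewrite !innerE (innerC y x); lra.
Qed.

(** Young's inequality with the optimal constant [<x, y> / <x, x>]. *)
Lemma CauchySchwarz_norm x y : `|inner x y| <= `|x| * `|y|.
Proof.
have [->|x0] := eqVneq x 0; first by rewrite inner0l !normr0 mul0r.
rewrite -(@ler_pXn2r _ 2) ?nnegrE ?mulr_ge0 // exprMn -!inner_normE.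
rewrite -normrX ger0_norm ?sqr_ge0 //.
have xx : 0 < inner x x by rewrite inner_normE exprn_gt0 // normr_gt0.
have := ler_wpM2r (ltW xx) (young (inner x y / inner x x) x y).
set a := inner x y; set b := inner x x; set c := inner y y.
have -> : 2 * (a / b) * a * b = 2 * a ^+ 2 by field; rewrite gt_eqF.
have -> : ((a / b) ^+ 2 * b + c) * b = a ^+ 2 + c * b by field; rewrite gt_eqF.
by lra.
Qed.

Lemma norm_le_inner (v : X) (K : R) : inner v v <= K -> `|v| <= K + 1.
Proof.
by rewrite inner_normE => H; have := sqr_ge0 (`|v| - 1); have := normr_ge0 v; nra.
Qed.

Lemma inner_inj x y : (forall z, inner x z = inner y z) -> x = y.
Proof.
move=> H; apply/eqP; rewrite -subr_eq0; apply/eqP/inner_eq0.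
by rewrite innerBl H subrr.
Qed.
End Inner.

(** Identities between linear combinations of vectors are checked after pairing both
    sides with an arbitrary vector, which turns them into identities of real
    polynomials. *)
Ltac vector := apply: inner_inj => ?; rewrite !innerE; ring.

(** * Proximity operators and subgradients *)

Section Prox.
Context {R : realType} {X : hilbertType R}.
Implicit Types (x y z p u v w : X) (phi : X -> \bar R).

Definition prox_objective phi x y : \bar R := (phi y + (2^-1 * `|y - x| ^+ 2)%:E)%E.

(** The parallelogram law: at a midpoint the quadratic term gains a definite amount
    over convexity.  It makes minimizing sequences Cauchy. *)
Lemma prox_objective_mid phi x a b ra rb : ereal_convex phi ->
  prox_objective phi x a = ra%:E -> prox_objective phi x b = rb%:E ->
  (prox_objective phi x (2^-1 *: a + (1 - 2^-1) *: b)%R <=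
     ((ra + rb) / 2 - 8^-1 * `|a - b| ^+ 2)%:E)%E.
Proof.
move=> cvx; rewrite /prox_objective.
have h01 : 0 < (2^-1 : R) < 1 by apply/andP; split; lra.
have := cvx a b _ h01.
case: (phi a) => [pa||] // + [<-]; case: (phi b) => [pb||] // + [<-].
rewrite -!EFinM -EFinD => H; apply: (le_trans (leeD2r _ H)).
rewrite -EFinD lee_fin -!inner_normE !innerE (innerC a x) (innerC b x) (innerC b a).
by lra.
Qed.

(** A minimizing sequence is Cauchy by [prox_objective_mid], and lower semicontinuity
    makes its limit a minimizer.  The lower bound is a hypothesis, so that the lemma
    also applies to continuous linear forms, before they are known to be inner
    products. *)
Lemma prox_exists phi x (l : R) : Gamma0 phi ->
  (forall y, (l%:E <= prox_objective phi x y)%E) -> exists p, argmin (prox_objective phi x) p.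
Proof.
move=> [cvx [phiN [y0 phiy0]] lsc] lb.
pose S := [set r : R | exists y, prox_objective phi x y = r%:E].
have S0 : S !=set0.
  move: phiy0 (phiN y0) => p1 p2.
  exists (fine (phi y0) + (2^-1 * `|y0 - x| ^+ 2)); exists y0.
  by rewrite /prox_objective; case: (phi y0) p1 p2.
have Slb : has_lbound S.
  by exists l => r [y Hy]; rewrite -lee_fin -Hy.
pose m := inf S.
have mle y : (m%:E <= prox_objective phi x y)%E.
  case E : (prox_objective phi x y) => [r||].
  - by rewrite lee_fin; apply: ge_inf => //; exists y.
  - by rewrite leey.
  - by have := lb y; rewrite E.
have appr n : exists yr : X * R, prox_objective phi x yr.1 = yr.2%:E /\ yr.2 < m + n.+1%:R^-1.
  have /(inf_adherent)/(_ (conj S0 Slb))[r [y Hy] Hr] : 0 < n.+1%:R^-1 :> R by [].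
  by exists (y, r).
have [yr Hyr] := choice appr.
pose u n := (yr n).1.
have step n k : `|u n - u k| ^+ 2 <= 4 * (n.+1%:R^-1 + k.+1%:R^-1).
  have [Hn ltn] := Hyr n; have [Hk ltk] := Hyr k.
  have := le_trans (mle _) (prox_objective_mid cvx Hn Hk).
  rewrite lee_fin -/(u n) -/(u k).
  move: ltn ltk; move: (n.+1%:R^-1) (k.+1%:R^-1) => en ek; lra.
have cu : cvg (u @ \oo).
  apply: cauchy_cvg; apply: cauchy_exP => e e0.
  have e8 : 0 < e ^+ 2 / 8 by rewrite divr_gt0 // exprn_gt0.
  have [N _ HN] := near_infty_natSinv_lt (PosNum e8).
  exists (u N); exists N => // n /= Nn; rewrite -ball_normE /=.
  rewrite -(@ltr_pXn2r _ 2) ?nnegrE ?(ltW e0) //.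
  apply: (le_lt_trans (step _ _)).
  have /= := HN N (leqnn N); have /= := HN n Nn.
  by move: (n.+1%:R^-1) (N.+1%:R^-1) => en ek; lra.
pose p := lim (u @ \oo).
exists p => y; apply: (le_trans _ (mle y)).
rewrite leNgt; apply/negP => mp.
(* If the value at [p] exceeded the infimum [m], some real [c] below [phi p] would
   still satisfy [m < c + q]; near [p] the objective stays above [c + q - eta], while
   along [u] it falls below [m + eta]. *)
pose q := 2^-1 * `|p - x| ^+ 2.
have [c cphi mc] : exists2 c : R, (c%:E < phi p)%E & m < c + q.
  move: mp; rewrite /prox_objective -/q; case: (phi p) (phiN p) => [r||] //.
    rewrite -EFinD lte_fin => _ mr; exists (r - (r + q - m) / 2); last by lra.
    by rewrite lte_fin; lra.
  by move=> _ _; exists (m - q + 1); [rewrite ltry | lra].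
have [V nV HV] := lsc _ _ cphi.
pose eta := (c + q - m) / 4.
have eta0 : 0 < eta by rewrite /eta; lra.
have cq : 2^-1 * `|u n - x| ^+ 2 @[n --> \oo] --> q.
  apply: cvgMl_tmp; rewrite expr2; under eq_cvg do rewrite expr2.
  have H : `|u n - x| @[n --> \oo] --> `|p - x|.
    by apply: cvg_norm; apply: cvgB; [exact: cu | exact: cvg_cst].
  exact: cvgM.
move/cvgr_dist_lt: cq => /(_ _ eta0) Q.
have W := cu _ nV.
have [n [/= Hn1 Hn2 Hn3]] : exists n, [/\ `|q - 2^-1 * `|u n - x| ^+ 2| < eta, V (u n) &
   n.+1%:R^-1 < eta].
  apply: (@filter_ex _ \oo).
  near=> n; split; near: n => //.
  exact: (near_infty_natSinv_lt (PosNum eta0)).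
have [E L] := Hyr n; rewrite -/(u n) in E.
have := HV _ Hn2; move: E; rewrite /prox_objective; case: (phi (u n)) => [r||] //.
rewrite -EFinD => -[E]; rewrite lte_fin => cr.
move: Hn1; rewrite ltr_norml => /andP[_ Hn1].
move: L; rewrite -E; move: Hn1 Hn3 mc cr; rewrite /eta.
move: (n.+1%:R^-1) (2^-1 * `|u n - x| ^+ 2) => en qn; clearbody q m; lra.
Unshelve. all: by end_near. Qed.

Lemma fin_subdiff phi x u : (forall x, phi x != -oo%E) -> (exists x, phi x != +oo%E) ->
  subdiff phi x u -> exists r, phi x = r%:E.
Proof.
move=> hN [y hy] hu; have := hu y; have := hN x.
case: (phi x) => [r||] // _; first by exists r.
by rewrite addye // leye_eq (negbTE hy).
Qed.

(** Fermat's rule, obtained by comparing the value at [p] with the values on the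
    segment from [p] to [y], to first order at [p]. *)
Lemma argmin_subdiff phi x p : Gamma0 phi -> argmin (prox_objective phi x) p ->
  subdiff phi p (x - p).
Proof.
move=> [cvx [phiN [y0 phiy0]] lsc] hp y.
have [rp rpE] : exists r, phi p = r%:E.
  have := hp y0; have := phiN p; rewrite /prox_objective; case: (phi p) => [r||] //.
    by exists r.
  by rewrite addye // leye_eq; case: (phi y0) phiy0 (phiN y0).
case yE : (phi y) (phiN y) => [ry||] // _; last by rewrite leey.
rewrite rpE -EFinD lee_fin -subr_le0.
apply: (@le0_vanishing _ _ (2^-1 * `|y - p| ^+ 2)); first by rewrite mulr_ge0 ?exprn_ge0 //.
move=> t t01; have /andP[t0 t1] := t01.
have := le_trans (hp (t *: y + (1 - t) *: p)) (leeD2r _ (cvx y p t t01)).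
rewrite /prox_objective rpE yE -!EFinM -!EFinD lee_fin => H.
rewrite -(ler_pM2l t0); move: H.
rewrite -!inner_normE !innerE (innerC x p) (innerC p y) (innerC x y).
nra.
Qed.

Lemma subdiff_mono phi a b u v :
  (forall x, phi x != -oo%E) -> (exists x, phi x != +oo%E) ->
  subdiff phi a u -> subdiff phi b v -> 0 <= inner (a - b) (u - v).
Proof.
move=> hN h0 hu hv.
have [ra Ea] := fin_subdiff hN h0 hu; have [rb Eb] := fin_subdiff hN h0 hv.
have := hu b; have := hv a; rewrite Ea Eb -!EFinD !lee_fin !innerE.
rewrite (innerC u a) (innerC u b) (innerC v a) (innerC v b); lra.
Qed.

Lemma subdiff_scale phi (c : R) x u : 0 < c ->
  subdiff phi x u <-> subdiff (fun y => c%:E * phi y)%E x (c *: u).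
Proof.
move=> c0; split=> H y; have := H y.
  rewrite innerZl EFinM -muleDr ?fin_num_adde_defl //.
  by rewrite lee_pmul2l.
rewrite innerZl EFinM -muleDr ?fin_num_adde_defl //.
by rewrite lee_pmul2l.
Qed.

Lemma Gamma0_scale phi (c : R) : 0 < c -> Gamma0 phi -> Gamma0 (fun y => c%:E * phi y)%E.
Proof.
move=> c0 [cvx [phiN [y0 phiy0]] lsc].
have cn y : (c%:E * phi y = -oo)%E -> phi y = -oo%E.
  by case: (phi y) => [r||] //; rewrite gt0_muley.
have cp y : (c%:E * phi y = +oo)%E -> phi y = +oo%E.
  by case: (phi y) => [r||] //; rewrite gt0_muleNy.
split.
- move=> x y t t01; have /andP[t0 t1] := t01.
  have := cvx x y t t01; rewrite -(@lee_pmul2l _ c%:E) //.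
  move=> H; apply: (le_trans H).
  rewrite muleDr //; last first.
    move: (phiN x) (phiN y); case: (phi x) => [r||] //; case: (phi y) => [r'||] // _ _;
    by rewrite ?gt0_muley // lte_fin subr_gt0.
  by rewrite (muleCA c%:E t%:E) (muleCA c%:E (1 - t)%:E).
- split; first by move=> x; apply/eqP => /cn; apply/eqP.
  by exists y0; apply/eqP => /cp; apply/eqP.
- move=> x a H.
  have [|V nV HV] := lsc x (a / c).
    by rewrite -(@lte_pmul2l _ c%:E) // -EFinM mulrC divfK // gt_eqF.
  exists V => // y /HV; rewrite -(@lte_pmul2l _ c%:E) // -EFinM mulrC divfK // gt_eqF //.
Qed.

(** A subgradient at one point gives an affine minorant, so the objective is bounded
    below by completing the square. *)
Lemma prox_argmin phi a u x : Gamma0 phi -> subdiff phi a u ->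
  argmin (prox_objective phi x) (prox phi x).
Proof.
move=> hphi hu; have [cvx [hN h0] lsc] := hphi; apply: xgetPex.
have [ra Ea] := fin_subdiff hN h0 hu.
apply: (@prox_exists _ _ (ra + inner u (x - a) - 2^-1 * inner u u)) => // y.
apply: (le_trans _ (leeD2r _ (hu y))).
rewrite Ea -!EFinD lee_fin -inner_normE.
have := young 1 (- u) (y - x).
by rewrite !innerE (innerC y x); lra.
Qed.

Lemma prox_subdiff phi a u x : Gamma0 phi -> subdiff phi a u ->
  subdiff phi (prox phi x) (x - prox phi x).
Proof. by move=> hphi hu; apply/argmin_subdiff/(prox_argmin _ hphi hu). Qed.

End Prox.

(** * Riesz representation and gradients *)

Section Riesz.
Context {R : realType} {X : hilbertType R}.
Implicit Types (x y z p u v w : X).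

(** The representative is the proximity point at 0 of [- L]: Fermat's rule there says
    that [L] lies below the inner product with [p], and a linear form lying below
    another one equals it. *)
Lemma riesz (L : X -> R) (C : R) :
  (forall a u v, L (a *: u + v) = a * L u + L v) -> (forall v, `|L v| <= C * `|v|) ->
  exists p, forall v, L v = inner p v.
Proof.
move=> Llin Lbd.
have LD u v : L (u + v) = L u + L v by have := Llin 1 u v; rewrite scale1r mul1r.
have L0 : L 0 = 0 by have := LD 0 0; rewrite addr0; lra.
have LZ a u : L (a *: u) = a * L u by rewrite -[a *: u]addr0 Llin L0 addr0.
have LB u v : L (u - v) = L u - L v by rewrite LD -scaleN1r LZ mulN1r.
pose phi y : \bar R := (- L y)%:E.
have G : Gamma0 phi.
  split.
  - move=> x y t _; rewrite /phi -!EFinM -EFinD lee_fin Llin LZ; lra.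
  - by split=> [//|]; exists 0.
  - move=> x a; rewrite lte_fin => ax.
    have C1 : 0 < `|C| + 1 by rewrite ltr_wpDl.
    have e0 : 0 < (- L x - a) / (`|C| + 1) by rewrite divr_gt0 // subr_gt0.
    exists (ball x ((- L x - a) / (`|C| + 1))); first exact: nbhsx_ballx.
    move=> y; rewrite -ball_normE /= ltr_pdivlMr // => H; rewrite lte_fin.
    have := Lbd (x - y); rewrite LB ler_norml => /andP[H1 _].
    have := ler_wpM2r (normr_ge0 (x - y)) (ler_norm C); have := normr_ge0 (x - y).
    lra.
have [|p /(argmin_subdiff G) Hp] := @prox_exists _ _ phi 0 (- (2^-1 * C ^+ 2)) G.
  move=> y; rewrite /prox_objective /phi -EFinD lee_fin subr0.
  have := Lbd y; rewrite ler_norml => /andP[_ H].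
  have := sqr_ge0 (C - `|y|); lra.
have key w : L w <= inner p w.
  have := Hp (w + p); rewrite /phi -EFinD lee_fin addrK sub0r !innerE LD; lra.
exists p => v; apply/eqP; rewrite eq_le key /=.
by have := key (-1 *: v); rewrite LZ innerZr; lra.
Qed.

Lemma gradP (h : X -> R) x v : differentiable h x -> 'd h x v = inner (grad h x) v.
Proof.
move=> hd.
suff H : [set u | forall v : X, 'd h x v = inner u v] (grad h x) by exact: H.
rewrite /grad; apply: xgetPex.
have dc : {for 0, continuous ('d h x)} by exact: diff_continuous hd 0.
have [C [_ HC]] := (linear_boundedP _).1 (continuous_linear_bounded 0 dc).
have /= HC1 := HC (`|C| + 1) (ltr_pwDr ltr01 (ler_norm C)).
have [p Hp] := @riesz ('d h x) (`|C| + 1) (fun a u v => linearP ('d h x) a u v) HC1.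
by exists p.
Qed.
End Riesz.

(** * Weak limits along filters *)

Section Weak.
Context {R : realType} {X : hilbertType R} {T : Type}.
Implicit Types (F : set_system T) (x y z : X) (u v : T -> X).

(** Weak convergence along an arbitrary filter; [weakly_cvg] is the case of
    [\oo]. *)
Definition wlim (F : set_system T) (u : T -> X) x :=
  forall y, inner (u i) y @[i --> F] --> inner x y.

(** Along an ultrafilter each [inner (u i) y], bounded in [i], converges; the limit is
    a bounded linear form in [y], which Riesz representation turns into a vector. *)
Lemma bounded_wlim (F : set_system T) (u : T -> X) (B : R) :
  UltraFilter F -> (forall i, `|u i| <= B) -> exists x, wlim F u x.
Proof.
move=> FU uB.
have PF : ProperFilter F by exact: ultra_proper.
have lim1 y : exists l, [/\ inner (u i) y @[i --> F] --> l & `|l| <= B * `|y|].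
  have cpt := @segment_compact R (- (B * `|y|)) (B * `|y|).
  have [|l [Hl cl]] := cpt (inner (u i) y @[i --> F]) _.
    apply: (filterE (F := F)) => i /=; rewrite in_itv /= -ler_norml.
    by apply: (le_trans (CauchySchwarz_norm _ _)); rewrite ler_wpM2r.
  have Fl : inner (u i) y @[i --> F] --> l.
    move=> V nV; have [//|FV] := in_ultra_setVsetC ((fun i => inner (u i) y) @^-1` V) FU.
    by have [r [/= nr r']] := cl (~` V) V FV nV.
  by exists l; split=> //; move: Hl; rewrite /= in_itv /= ler_norml.
have [L HL] := choice lim1.
have Luniq y l : inner (u i) y @[i --> F] --> l -> L y = l.
  by move=> H; apply: (cvg_unique _ (HL y).1 H).
have [|v|x Hx] := @riesz _ _ L B; last 1 first.
- by exists x => y; rewrite -Hx; exact: (HL y).1.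
- move=> a v w; apply: Luniq.
  under eq_cvg do rewrite innerDr innerZr.
  apply: cvgD; last exact: (HL w).1.
  by apply: cvgMl_tmp; exact: (HL v).1.
- exact: (HL v).2.
Qed.

Lemma wlimD F {FF : Filter F} u v x y :
  wlim F u x -> wlim F v y -> wlim F (fun i => u i + v i) (x + y).
Proof.
move=> hu hv z; rewrite innerDl; under eq_cvg do rewrite innerDl.
exact: cvgD.
Qed.
Lemma wlimZ F {FF : Filter F} a u x : wlim F u x -> wlim F (fun i => a *: u i) (a *: x).
Proof.
move=> hu z; rewrite innerZl; under eq_cvg do rewrite innerZl.
by apply: cvgMl_tmp.
Qed.
Lemma wlimB F {FF : Filter F} u v x y :
  wlim F u x -> wlim F v y -> wlim F (fun i => u i - v i) (x - y).
Proof.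
move=> hu hv z; rewrite innerBl; under eq_cvg do rewrite innerBl.
exact: cvgB.
Qed.
Lemma wlim_cst F {FF : Filter F} x : wlim F (fun => x) x.
Proof. by move=> z; exact: cvg_cst. Qed.
Lemma wlim_sum F {FF : Filter F} (I : Type) (r : seq I) (u : I -> T -> X) (x : I -> X) :
  (forall i, wlim F (u i) (x i)) ->
  wlim F (fun k => \sum_(i <- r) u i k) (\sum_(i <- r) x i).
Proof.
move=> h; elim: r => [|i r IH].
  under [X in wlim _ X]eq_fun do rewrite big_nil; rewrite big_nil; exact: wlim_cst.
under [X in wlim _ X]eq_fun do rewrite big_cons; rewrite big_cons; exact: wlimD.
Qed.

Lemma inner_cvg0 F {FF : Filter F} (u v : T -> X) (B : R) :
  inner (u i) (u i) @[i --> F] --> 0 -> (forall i, `|v i| <= B) ->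
  inner (u i) (v i) @[i --> F] --> 0.
Proof.
move=> u0 vB; apply/cvgr0Pnorm_lt => e e0.
have B1 : 0 < `|B| + 1 by rewrite ltr_wpDl.
have d0 : 0 < (e / (`|B| + 1)) ^+ 2 by rewrite exprn_gt0 // divr_gt0.
move/cvgr0Pnorm_lt: u0 => /(_ _ d0); apply: filterS => i.
rewrite ger0_norm ?inner_ge0 // inner_normE ltr_pXn2r ?nnegrE ?divr_ge0 ?(ltW e0) ?(ltW B1) //.
rewrite ltr_pdivlMr // => H; apply: (le_lt_trans (CauchySchwarz_norm _ _)).
apply: (le_lt_trans _ H); rewrite ler_wpM2l // (le_trans (vB i)) //.
by rewrite (le_trans (ler_norm B)) // lerDl.
Qed.

Lemma strong_wlim F {FF : Filter F} (u : T -> X) x :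
  inner (u i - x) (u i - x) @[i --> F] --> 0 -> wlim F u x.
Proof.
move=> ux y.
have H : inner (u i - x) y @[i --> F] --> 0 by exact: inner_cvg0 ux (fun=> lexx `|y|).
under eq_cvg do rewrite -[u _](subrK x) innerDl.
by rewrite -[inner x y]add0r; apply: cvgD => //; rewrite add0r; exact: cvg_cst.
Qed.


(** If the preimage of a neighborhood of [l] were not in [F], its complement could be
    added to [F], and an ultrafilter finer than the result would contradict the
    hypothesis. *)
Lemma cvg_ultra F {FF : ProperFilter F} (a : T -> R) (l : R) :
  (forall U, UltraFilter U -> F `<=` U -> a @ U --> l) -> a @ F --> l.
Proof.
move=> H V nV; apply: contrapT => nA.
pose A := a @^-1` V.
have PG : ProperFilter (within (~` A) F).
  split; last exact: within_filter.
  move=> W; apply: nA.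
  apply: (@filterS _ F _ (fun i => ~ A i -> False)) W => i W.
  by apply: contrapT => nv; exact: W nv.
have [U [UU sU]] := ultraFilterLemma PG.
have sFU : F `<=` U by move=> B hB; apply: sU; apply: filterS hB => i Bi _.
have PU : ProperFilter U by exact: ultra_proper.
have UA : U A by exact: H UU sFU V nV.
have UnA : U (~` A) by apply: sU; exact: withinT.
by have [i [p q]] := filter_ex (filterI UA UnA); exact: q p.
Qed.

End Weak.

(** * Convex functions with Lipschitz gradient *)

(** The descent inequality at [b], taken at the point one gradient step of length
    [1 / beta] away, is compared with the affine minorant at [a]; exchanging the two
    points and adding gives cocoercivity. *)
Lemma baillon_haddad {R : realType} {X : hilbertType R} (h : X -> R) (G : X -> X) (beta : R) :
  0 < beta -> (forall x y, h x + inner (G x) (y - x) <= h y) ->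
  (forall x y, h y <= h x + inner (G x) (y - x) + beta / 2 * inner (y - x) (y - x)) ->
  forall x y, inner (G x - G y) (G x - G y) <= beta * inner (x - y) (G x - G y).
Proof.
move=> beta0 ineq desc.
have gap a b : inner (G a - G b) (G a - G b) <=
   2 * beta * (h b - h a - inner (G a) (b - a)).
  have := ineq a (b - beta^-1 *: (G b - G a)).
  have := desc b (b - beta^-1 *: (G b - G a)).
  have -> : inner (G a - G b) (G a - G b) = inner (G b - G a) (G b - G a).
    by rewrite -opprB innerNl innerNr opprK.
  have := innerBl (G b) (G a) (G b - G a).
  move: (G b - G a) => g gE.
  have -> : b - beta^-1 *: g - b = - (beta^-1 *: g) by rewrite addrAC subrr add0r.
  have -> : b - beta^-1 *: g - a = (b - a) - beta^-1 *: g by rewrite addrAC.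
  rewrite innerBr !innerNr !innerNl !innerZr !innerZl; move: gE.
  move: (inner g g) (inner (G b) g) (inner (G a) g) (inner (G a) (b - a)) => N p q r Npq H1 H2.
  have H : h a + (r - beta^-1 * q) <= h b - beta^-1 * p + beta / 2 * (beta^-1 * (beta^-1 * N)).
    by move: H1 H2; move: (h _) => z; lra.
  have b2 : 0 <= 2 * beta by rewrite mulr_ge0 // ltW.
  have := ler_wpM2l b2 H.
  have -> : 2 * beta * (h a + (r - beta^-1 * q)) = 2 * beta * (h a + r) - 2 * q.
    by field; rewrite gt_eqF.
  have -> : 2 * beta * (h b - beta^-1 * p + beta / 2 * (beta^-1 * (beta^-1 * N))) =
      2 * beta * h b - 2 * p + N.
    by field; rewrite gt_eqF.
  lra.
move=> x y; have := gap x y; have := gap y x.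
rewrite -(opprB (G x)) innerNl innerNr opprK -(opprB x y) innerNr (innerC (x - y)).
rewrite (innerBl (G x) (G y) (x - y)).
move: (inner (G x - G y) _) (inner (G x) _) (inner (G y) _) (h x) (h y) => A B C D E; lra.
Qed.

Section Grad.
Context {R : realType} {X : hilbertType R}.
Implicit Types (x y z p u v w : X).
Variables (h : X -> R).
Hypothesis hconv : convex_function [set: convex_lmodType X] h.
Hypothesis hdiff : forall x : X, differentiable h x.

Lemma convex_funE x y (t : R) : 0 < t < 1 ->
  h (t *: x + (1 - t) *: y) <= t * h x + (1 - t) * h y.
Proof.
move=> /andP[t0 t1].
exact: (hconv (Itv01 (ltW t0) (ltW t1)) (mem_setT x) (mem_setT y)).
Qed.

(** By convexity the difference quotients of [h] along the segment are at most
    [h y - h x], and they tend to the directional derivative. *)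
Lemma grad_subgradient x y : h x + inner (grad h x) (y - x) <= h y.
Proof.
rewrite -gradP // -deriveE // -lerBrDl leNgt; apply/negP => H.
have e0 : 0 < 'D_(y - x) h x - (h y - h x) by rewrite subr_gt0.
have cv : t^-1 *: (h (t *: (y - x) + x) - h x) @[t --> 0^'] --> 'D_(y - x) h x.
  exact: (@diff_derivable _ _ _ h x (y - x)).
move/cvgr_dist_lt: cv => /(_ _ e0) [d /= d0 Hd].
pose t := Num.min (d / 2) 2^-1.
have t0 : 0 < t by rewrite lt_min; apply/andP; split; [apply: divr_gt0|].
have td : t < d by rewrite gt_min; apply/orP; left; lra.
have t1 : t < 1 by rewrite gt_min; apply/orP; right; lra.
have := Hd t; rewrite /= sub0r normrN gtr0_norm // td => /(_ isT).
rewrite gt_eqF // => /(_ isT).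
have t01 : 0 < t < 1 by rewrite t0 t1.
have -> : t *: (y - x) + x = t *: y + (1 - t) *: x.
  by rewrite scalerBr scalerBl scale1r -addrA (addrC x) addrA.
have := convex_funE y x t01; set q := h (_ + _) => cvx.
have : t^-1 *: (q - h x) <= h y - h x.
  by rewrite [t^-1 *: _]mulrC ler_pdivrMr //; lra.
set s := t^-1 *: _ => sle; rewrite ltr_norml => /andP[_].
move: sle; lra.
Qed.

Variable beta : R.
Hypothesis beta0 : 0 < beta.
Hypothesis hlip : beta.-lipschitz (grad h).

Lemma grad_lip x y : `|grad h x - grad h y| <= beta * `|x - y|.
Proof. exact: (@hlip (x, y) (conj I I)). Qed.

(** No integration is needed: on a subdivision of the segment into [n + 1] equal
    pieces, the gradient inequality at the end of each piece and the Lipschitz bound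
    give a Riemann sum, which exceeds its limit by a term of order [1 / (n + 1)]. *)
Lemma descent x y : h y <= h x + inner (grad h x) (y - x) + beta / 2 * inner (y - x) (y - x).
Proof.
set d := y - x; set N := inner d d.
have step n k : h (x + (k%:R / n.+1%:R) *: d) <= h x + (k%:R / n.+1%:R) * inner (grad h x) d
    + beta * N * (\sum_(i < k) i.+1%:R) / n.+1%:R ^+ 2.
  elim: k => [|k IH].
    by rewrite big_ord0 !mulr0 !mul0r scale0r !addr0.
  rewrite big_ord_recr /=; set a := k%:R / _ in IH *; set S := \sum_(i < k) _ in IH *.
  have n0 : (n.+1%:R : R) != 0 by [].
  have -> : k.+1%:R / n.+1%:R = a + n.+1%:R^-1 :> R.
    by rewrite -(natr1 k) mulrDl mul1r.
  set i := n.+1%:R^-1; set p := x + (a + i) *: d; set g := grad h p.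
  have i0 : 0 <= i by rewrite invr_ge0 ler0n.
  have ai0 : 0 <= a + i by rewrite addr_ge0 // divr_ge0 ?ler0n.
  have H1 : h p <= h (x + a *: d) + i * inner g d.
    have := grad_subgradient p (x + a *: d); rewrite -/g.
    have -> : x + a *: d - p = (- i) *: d.
      by rewrite /p opprD addrACA subrr add0r -scalerBl opprD addrA subrr add0r.
    by rewrite innerZr mulNr lerBlDr.
  have H2 : inner g d <= inner (grad h x) d + beta * N * (a + i).
    rewrite -lerBlDl -innerBl.
    apply: (le_trans (le_trans (ler_norm _) (CauchySchwarz_norm _ _))).
    apply: (le_trans (ler_wpM2r (normr_ge0 d) (grad_lip p x))).
    rewrite /p (addrC x) addrK normrZ ger0_norm // /N inner_normE.
    by rewrite le_eqVlt; apply/orP; left; apply/eqP; ring.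
  have -> : beta * N * (S + k.+1%:R) / n.+1%:R ^+ 2 = beta * N * S / n.+1%:R ^+ 2 +
      i * (beta * N * (a + i)).
    by rewrite /i /a -(natr1 k); move: (n.+1%:R : R) n0 => nn n0; field.
  have H3 := ler_wpM2l i0 H2.
  apply: (le_trans H1); apply: (le_trans (lerD IH H3)).
  by rewrite mulrDr mulrDl -!addrA lerD2l lerD2l addrCA.
have fin n : h y <= h x + inner (grad h x) d + beta / 2 * N + (beta / 2 * N) * n.+1%:R^-1.
  have := step n n.+1; rewrite divff // scale1r mul1r.
  rewrite {1}/d addrC subrK => H; apply: (le_trans H).
  have -> : \sum_(i < n.+1) (i.+1%:R : R) = n.+1%:R * (n.+1%:R + 1) / 2.
    elim: n {H} => [|n IH]; first by rewrite big_ord1 /=; field.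
    by rewrite big_ord_recr /= IH -(natr1 n.+1); field.
  suff -> : beta * N * (n.+1%:R * (n.+1%:R + 1) / 2) / n.+1%:R ^+ 2 =
    beta / 2 * N + (beta / 2 * N) * n.+1%:R^-1 by rewrite addrA.
  by field.
rewrite -subr_le0; apply: (@le0_vanishing _ _ (beta / 2 * N)).
  by rewrite mulr_ge0 ?inner_ge0 // divr_ge0 // ltW.
move=> t /andP[t0 t1]; have [n _ /(_ n (leqnn n)) /= Hn] := near_infty_natSinv_lt (PosNum t0).
have N0 : 0 <= beta / 2 * N by rewrite mulr_ge0 ?inner_ge0 // divr_ge0 // ltW.
have := ler_wpM2l N0 (ltW Hn); have := fin n.
move: (beta / 2 * N) (inner (grad h x) d) (h x) (h y) (n.+1%:R^-1) => A B C D E; lra.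
Qed.

Lemma cocoercive x y :
  inner (grad h x - grad h y) (grad h x - grad h y) <=
  beta * inner (x - y) (grad h x - grad h y).
Proof. exact: baillon_haddad grad_subgradient descent x y. Qed.
End Grad.

(** * Weak limits of pairs in the graph of a subdifferential *)

Section Minty.
Context {R : realType} {X : hilbertType R} {T : Type}.
Implicit Types (x y z p w : X) (phi : X -> \bar R).

(** Minty's trick: monotonicity is tested against the resolvent [p] of [a' + u'].
    Products of two weakly convergent sequences need not converge, but here the only
    such product is the defect, which tends to 0 by hypothesis.  When the right-hand
    side is nonpositive, [a' = p] and the limiting pair is in the graph. *)
Lemma minty_wlim_gap (F : set_system T) {PF : ProperFilter F} phi
  (a u : T -> X) a' u' a0 u0 p :
  Gamma0 phi -> (forall k, subdiff phi (a k) (u k)) ->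
  wlim F a a' -> wlim F u u' ->
  inner (a k - a0) (u k - u0) @[k --> F] --> 0 ->
  subdiff phi p (a' + u' - p) ->
  inner (a' - p) (a' - p) <= - inner (a' - a0) (u' - u0).
Proof.
move=> [_ [phiN phiP] _] hau wa wu au0 hp.
set w := a' + u' - p in hp.
have pos k : 0 <= inner (a k - p) (u k - w) by exact: subdiff_mono phiN phiP (hau k) hp.
pose c := inner (a0 - p) (u0 - w) - inner a0 (u0 - w) - inner u0 (a0 - p).
have : inner (a k - a0) (u k - u0) + (inner (a k) (u0 - w) + inner (u k) (a0 - p) + c)
    @[k --> F] --> 0 + (inner a' (u0 - w) + inner u' (a0 - p) + c).
  apply: cvgD => //; apply: cvgD; last exact: cvg_cst.
  by apply: cvgD; [exact: wa | exact: wu].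
have E b v : inner (b - a0) (v - u0) + (inner b (u0 - w) + inner v (a0 - p) + c) =
    inner (b - p) (v - w).
  rewrite /c !innerE (innerC v a0) (innerC v p) (innerC u0 a0) (innerC u0 p); ring.
under eq_cvg do rewrite E.
move=> cv.
have : 0 <= 0 + (inner a' (u0 - w) + inner u' (a0 - p) + c).
  apply: (@closed_cvg _ _ F _ _ (fun r : R => 0 <= r) (@closed_ge R 0) _ _ cv).
  exact: filterE.
rewrite -(lerD2l (inner (a' - a0) (u' - u0))) add0r E addr0.
have -> : u' - w = - (a' - p) by rewrite /w; vector.
rewrite innerNr; lra.
Qed.
End Minty.

(** * One step of the splitting scheme *)

Section Splitting.
Context {R : realType} {X : hilbertType R} {M : nat}.
Variables (F : X -> \bar R) (G : 'I_M -> X -> \bar R) (C : X -> X).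
Variables (tau beta : R) (omega : 'I_M -> R).
Implicit Types (x y z : X) (s t r : 'I_M -> X).
Hypothesis hF : Gamma0 F.
Hypothesis hG : forall m, Gamma0 (G m).
Hypothesis beta0 : 0 < beta.
Hypothesis tau0 : 0 < tau.
Hypothesis C_cocoercive : forall x y,
  inner (C x - C y) (C x - C y) <= beta * inner (x - y) (C x - C y).
Hypothesis omega0 : forall m, 0 < omega m.
Hypothesis omega1 : \sum_(m < M) omega m = 1.
Let delta := 2 - tau * beta / 2.

Definition avg s : X := \sum_(m < M) omega m *: s m.
Definition wdot s t : R := \sum_(m < M) omega m * inner (s m) (t m).

(** The optimality conditions of the proximal evaluations at [s]: [F] stands for
    [tau f], [G m] for [tau / omega_m g_m] and [C] for the gradient of [h].  The fixed
    states are those for which all the [y m] equal [x]. *)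
Definition prox_outputs s x (y : 'I_M -> X) := subdiff F x (avg s - x) /\
  forall m, subdiff (G m) (y m) (2 *: x - s m - tau *: C x - y m).

Lemma omega_cst (a : R) : \sum_(m < M) omega m * a = a.
Proof. by rewrite -mulr_suml omega1 mul1r. Qed.

Lemma avgB s t : avg s - avg t = avg (fun m => s m - t m).
Proof. by rewrite /avg -sumrB; apply: eq_bigr => m _; rewrite scalerBr. Qed.

Lemma inner_avg x s : inner x (avg s) = \sum_(m < M) omega m * inner x (s m).
Proof. by rewrite inner_sumr; apply: eq_bigr => m _; rewrite innerZr. Qed.

Lemma wdot_ge0 s : 0 <= wdot s s.
Proof. by apply: sumr_ge0 => m _; rewrite mulr_ge0 ?inner_ge0 // ltW. Qed.

Lemma wdot_ge_term s m : omega m * inner (s m) (s m) <= wdot s s.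
Proof.
rewrite /wdot (bigD1 m) //= lerDl; apply: sumr_ge0 => i _.
by rewrite mulr_ge0 ?inner_ge0 // ltW.
Qed.

Lemma wdot_bound s m K : wdot s s <= K -> `|s m| <= K / omega m + 1.
Proof.
move=> H; apply: norm_le_inner; rewrite ler_pdivlMr // mulrC.
exact: le_trans (wdot_ge_term s m) H.
Qed.

(** The contribution of one index [m] to [residual_cocoercive].  The cross term
    between the residual and the gradient is absorbed, by Young's inequality, in the
    cocoercivity term at the price of [tau * beta / 4] times the squared residual:
    this is where the value of [delta] comes from. *)
Lemma residual_term_le (dx ds dr c : X) : inner c c <= beta * inner dx c ->
  0 <= inner (dx + dr) (dx - ds - tau *: c - dr) ->
  inner ds dr + delta / 2 * inner dr dr <= inner dx dx - inner dx ds.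
Proof.
move=> hc.
have := young (- (beta / 2)) dr c.
rewrite !innerE (innerC dr dx) (innerC dr ds) => Y.
have H : - inner dr c <= beta / 4 * inner dr dr + inner dx c.
  rewrite -(ler_pM2l beta0); move: hc Y.
  move: (inner c c) (inner dr c) (inner dx c) (inner dr dr) => p q r z; nra.
have := ler_wpM2l (ltW tau0) H; rewrite /delta.
move: (inner dr c) (inner dx c) (inner dr dr) (inner dx dx) (inner dx ds) (inner ds dr) (inner dx dr).
move=> p q r z a b e; lra.
Qed.

Section TwoStates.
Variables (s t : 'I_M -> X) (x x' : X) (y y' : 'I_M -> X).
Hypothesis Hs : prox_outputs s x y.
Hypothesis Ht : prox_outputs t x' y'.
Let ds m := s m - t m.
Let dr m := (y m - x) - (y' m - x').
Let dx := x - x'.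
Let c := C x - C x'.

Lemma proxF_monotone : 0 <= inner dx (avg ds - dx).
Proof.
have [_ [hN hP] _] := hF.
have := subdiff_mono hN hP Hs.1 Ht.1.
rewrite (_ : avg s - x - (avg t - x') = avg ds - dx) //.
by rewrite -avgB /dx; vector.
Qed.

Lemma proxG_monotone m : 0 <= inner (dx + dr m) (dx - ds m - tau *: c - dr m).
Proof.
have [_ [hN hP] _] := hG m.
have := subdiff_mono hN hP (Hs.2 m) (Ht.2 m).
have -> : y m - y' m = dx + dr m by rewrite /dx /dr; vector.
congr (0 <= inner _ _); rewrite /dx /ds /dr /c; vector.
Qed.

(** When [delta > 1] this says that the map from [s] to [s + r] is averaged with
    constant [1 / delta] for the weighted inner product. *)
Lemma residual_cocoercive : 2 * wdot ds dr + delta * wdot dr dr <= 0.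
Proof.
have H m : omega m * (inner (ds m) (dr m) + delta / 2 * inner (dr m) (dr m)) <=
    omega m * (inner dx dx - inner dx (ds m)).
  by rewrite ler_pM2l // (residual_term_le (C_cocoercive x x') (proxG_monotone m)).
have : \sum_(m < M) (omega m * inner (ds m) (dr m) + delta / 2 * (omega m * inner (dr m) (dr m)))
    <= \sum_(m < M) (omega m * inner dx dx - omega m * inner dx (ds m)).
  by apply: ler_sum => m _; have := H m; rewrite mulrDr mulrBr (mulrCA _ (delta / 2)).
rewrite big_split /= -mulr_sumr sumrB omega_cst -inner_avg -/(wdot ds dr) -/(wdot dr dr).
have := proxF_monotone; rewrite innerBr; lra.
Qed.

Lemma proxF_nonexpansive : inner dx dx <= wdot ds ds.
Proof.
have H : 2 * inner dx (avg ds) <= inner dx dx + wdot ds ds.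
  rewrite inner_avg mulr_sumr -[inner dx dx]omega_cst -big_split /=.
  apply: ler_sum => m _; rewrite mulrCA -mulrDr ler_pM2l //.
  by have := young 1 dx (ds m); lra.
have := proxF_monotone; rewrite innerBr; lra.
Qed.

End TwoStates.

(** * The iteration *)

Section Iteration.
Hypothesis delta_gt0 : 0 < delta.
Hypothesis C_lipschitz : forall x y, `|C x - C y| <= beta * `|x - y|.
Variables (rho : nat -> R) (s : nat -> 'I_M -> X) (x : nat -> X) (y : nat -> 'I_M -> X).
Hypothesis hrho : forall i, 0 <= rho i <= delta.
Hypothesis hsum : (\sum_(0 <= i <oo) (rho i * (delta - rho i))%:E = +oo)%E.
Hypothesis hev : forall i, prox_outputs (s i) (x i) (y i).
Hypothesis hstep : forall i m, s i.+1 m = s i m + rho i *: (y i m - x i).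

Let r i m := y i m - x i.
Let res i := wdot (r i) (r i).

Lemma wdot_addZ (a b : 'I_M -> X) (c : R) :
  wdot (fun m => a m + c *: b m) (fun m => a m + c *: b m) =
  wdot a a + 2 * c * wdot a b + c ^+ 2 * wdot b b.
Proof.
rewrite /wdot !mulr_sumr -!big_split /=; apply: eq_bigr => m _.
rewrite !innerE (innerC (b m)); ring.
Qed.

(** [residual_cocoercive] between consecutive states, whose difference is [rho] times
    the residual: as [rho <= delta], its quadratic term dominates the one in the
    expansion of the new squared residual. *)
Lemma residual_decr i : res i.+1 <= res i.
Proof.
have := residual_cocoercive (hev i.+1) (hev i).
set ds := fun m => s i.+1 m - s i m; set dr := fun m => _ - _ => K.
have dsE : wdot ds dr = rho i * wdot (r i) dr.
  rewrite /wdot mulr_sumr; apply: eq_bigr => m _.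
  by rewrite /ds hstep (addrC (s i m)) addrK innerZl mulrCA.
have resE : res i.+1 = res i + 2 * 1 * wdot (r i) dr + 1 ^+ 2 * wdot dr dr.
  rewrite /res -wdot_addZ; congr (wdot _ _); apply/funext => m; rewrite /dr /r; vector.
have /andP[r0 rd] := hrho i; have d0 := wdot_ge0 dr.
(* When [rho i = 0] nothing can be divided by [rho i], but the state does not move. *)
have [rz|rn] := eqVneq (rho i) 0.
  have ds0 m : s i.+1 m = s i m by rewrite hstep rz scale0r addr0.
  have : wdot dr dr <= 0 by move: K; rewrite dsE rz mul0r mulr0 add0r pmulr_rle0 //.
  move: (wdot_ge_term dr) => G1 G2.
  have z m : dr m = 0.
    apply: inner_eq0; rewrite -(pmulr_rle0 _ (omega0 m)); exact: le_trans (G1 m) G2.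
  rewrite resE !mulr1 expr1n mul1r.
  have -> : wdot (r i) dr = 0 by rewrite /wdot big1 // => m _; rewrite z inner0r mulr0.
  have -> : wdot dr dr = 0 by rewrite /wdot big1 // => m _; rewrite z inner0r mulr0.
  by rewrite mulr0 !addr0.
have rp : 0 < rho i by rewrite lt_neqAle eq_sym rn.
rewrite dsE in K.
suff : 2 * wdot (r i) dr + wdot dr dr <= 0 by rewrite resE; lra.
rewrite -(pmulr_rle0 _ rp); have := ler_wpM2r d0 rd.
by move: K; move: (wdot (r i) dr) (wdot dr dr) => A B; lra.
Qed.

Lemma residual_mono : {homo res : i j / (i <= j)%N >-> j <= i}.
Proof.
by apply: homo_leq => [//|a b c H1 H2|i]; [exact: le_trans H2 H1|exact: residual_decr].
Qed.

Section FixedPoint.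
Variables (t : 'I_M -> X) (z : X).
Hypothesis ht : prox_outputs t z (fun=> z).
Let dist i := wdot (fun m => s i m - t m) (fun m => s i m - t m).

Lemma residual_fixed i : 2 * wdot (fun m => s i m - t m) (r i) + delta * res i <= 0.
Proof.
have := residual_cocoercive (hev i) ht.
by have -> : (fun m => y i m - x i - (z - z)) = r i by apply/funext => m; rewrite subrr subr0.
Qed.

Lemma dist_step i : dist i.+1 <= dist i - rho i * (delta - rho i) * res i.
Proof.
have /andP[r0 rd] := hrho i.
have -> : dist i.+1 = dist i + 2 * rho i * wdot (fun m => s i m - t m) (r i) + rho i ^+ 2 * res i.
  rewrite /dist /res -wdot_addZ; congr (wdot _ _);
  by apply/funext => m; rewrite hstep addrAC.
have := ler_wpM2l r0 (residual_fixed i).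
by move: (wdot _ (r i)) (dist i) (res i) => A B D; lra.
Qed.

Lemma dist_decr i : dist i.+1 <= dist i.
Proof.
have /andP[r0 rd] := hrho i; apply: (le_trans (dist_step i)).
by rewrite gerBl mulr_ge0 ?wdot_ge0 // mulr_ge0 // subr_ge0.
Qed.

Lemma dist_bound i : dist i <= dist 0%N.
Proof. by elim: i => // i; apply: le_trans (dist_decr i). Qed.

(** The drops of the distance have a bounded sum, so the squared residual cannot stay
    above a positive number: the weights would be summable.  Being nonincreasing, it
    tends to 0. *)
Lemma residual_cvg0 : res i @[i --> \oo] --> 0.
Proof.
apply/cvgr0Pnorm_lt => e e0.
have [k Hk] : exists k, res k < e.
  apply/not_existsP => H.
  have He i : e <= res i by rewrite leNgt; apply/negP/H.
  have part n : \sum_(0 <= i < n) (rho i * (delta - rho i)) <= dist 0%N / e.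
    rewrite ler_pdivlMr //.
    have : (\sum_(0 <= i < n) (rho i * (delta - rho i))) * e <= dist 0%N - dist n.
      elim: n => [|n IH]; first by rewrite big_geq // mul0r subrr.
      rewrite big_nat_recr //= mulrDl.
      have /andP[r0 rd] := hrho n.
      have c0 : 0 <= rho n * (delta - rho n) by rewrite mulr_ge0 // subr_ge0.
      have := dist_step n; have := ler_wpM2l c0 (He n); move: IH.
      move: (\sum_(_ <= _ < _) _) (dist _) (dist _) (dist _) => A B D E; lra.
    move/le_trans; apply; rewrite gerBl; exact: wdot_ge0.
  suff : (\sum_(0 <= i <oo) (rho i * (delta - rho i))%:E <= (dist 0%N / e)%:E)%E.
    by rewrite hsum leye_eq.
  apply: lime_le.
    apply: is_cvg_nneseries => n _ _; rewrite lee_fin.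
    by have /andP[r0 rd] := hrho n; rewrite mulr_ge0 // subr_ge0.
  by apply: nearW => n; rewrite sumEFin lee_fin.
exists k => // n /= kn; rewrite ger0_norm; last exact: wdot_ge0.
exact: le_lt_trans (residual_mono kn) Hk.
Qed.

Lemma r_cvg0 m : inner (r i m) (r i m) @[i --> \oo] --> 0.
Proof.
apply: (@squeeze_cvgr _ _ _ _ (fun=> 0) (fun i => (omega m)^-1 * res i)).
- apply: nearW => i; rewrite inner_ge0 /= mulrC ler_pdivlMr // mulrC; exact: wdot_ge_term.
- exact: cvg_cst.
- by rewrite -[X in _ --> X](mulr0 (omega m)^-1); apply: cvgMl_tmp; exact: residual_cvg0.
Qed.


(** The monotonicity defects, between the iterates and the fixed state, of the
    subdifferentials of [F] and [G m] and of [C]. *)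
Let defF i := inner (x i - z) ((avg (s i) - x i) - (avg t - z)).
Let defG i m := inner (y i m - z)
  ((2 *: x i - s i m - tau *: C (x i) - y i m) - (2 *: z - t m - tau *: C z - z)).
Let defC i := inner (x i - z) (C (x i) - C z).
Let err i := \sum_(m < M) omega m *
  inner (r i m) (- (s i m - t m) - tau *: (C (x i) - C z) - r i m).

Lemma defF_ge0 i : 0 <= defF i.
Proof.
have [_ [hN hP] _] := hF; exact: subdiff_mono hN hP (hev i).1 ht.1.
Qed.
Lemma defG_ge0 i m : 0 <= defG i m.
Proof.
have [_ [hN hP] _] := hG m; exact: subdiff_mono hN hP ((hev i).2 m) (ht.2 m).
Qed.
Lemma defC_ge i : inner (C (x i) - C z) (C (x i) - C z) <= beta * defC i.
Proof. exact: C_cocoercive. Qed.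
Lemma defC_ge0 i : 0 <= defC i.
Proof. by rewrite -(pmulr_rge0 _ beta0) (le_trans (inner_ge0 _) (defC_ge i)). Qed.

(** The subgradients and the gradient cancel at the fixed state, and up to the residual
    at the iterates; so only terms containing the residual survive in the sum. *)
Lemma defect_sum i : defF i + \sum_(m < M) omega m * defG i m + tau * defC i = err i.
Proof.
have -> : defF i = \sum_(m < M) omega m * inner (x i - z) ((s i m - t m) - (x i - z)).
  under eq_bigr do rewrite innerBr mulrBr.
  rewrite sumrB omega_cst -inner_avg -avgB -innerBr /defF; congr (inner _ _); vector.
rewrite -[tau * _]omega_cst -!big_split /=; apply: eq_bigr => m _.
rewrite -!mulrDr; congr (_ * _).
rewrite /defG /defC /r; move: (C (x i)) (C z) => c c'.
have -> : y i m - z = (x i - z) + (y i m - x i) by vector.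
have -> : 2 *: x i - s i m - tau *: c - y i m - (2 *: z - t m - tau *: c' - z) =
  (x i - z) - (s i m - t m) - tau *: (c - c') - (y i m - x i) by vector.
move: (x i - z) (y i m - x i) (s i m - t m) (c - c') => a b d e.
by rewrite !innerE; rewrite (innerC b a); ring.
Qed.

Lemma ds_bound m : exists B, forall i, `|s i m - t m| <= B.
Proof.
exists (dist 0%N / omega m + 1) => i.
exact: (@wdot_bound (fun m => s i m - t m)) (dist_bound i).
Qed.

Lemma dx_bound : exists B, forall i, `|x i - z| <= B.
Proof.
exists (dist 0%N + 1) => i; apply: norm_le_inner.
exact: le_trans (proxF_nonexpansive (hev i) ht) (dist_bound i).
Qed.

Lemma dC_bound : exists B, forall i, `|C (x i) - C z| <= B.
Proof.
have [B HB] := dx_bound; exists (beta * B) => i.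
by apply: (le_trans (C_lipschitz _ _)); rewrite ler_pM2l.
Qed.

Lemma r_bound m : exists B, forall i, `|r i m| <= B.
Proof.
exists (res 0%N / omega m + 1) => i; apply: (@wdot_bound (r i)).
exact: residual_mono (leq0n i).
Qed.

Lemma err_cvg0 : err i @[i --> \oo] --> 0.
Proof.
have -> : (0 : R) = \sum_(m < M) omega m * 0 by rewrite big1 // => m _; rewrite mulr0.
apply: cvg_big; [exact: add_continuous | move=> m _; apply: cvgMl_tmp].
have [B1 H1] := ds_bound m; have [B2 H2] := dC_bound; have [B3 H3] := r_bound m.
apply: (inner_cvg0 (B := B1 + tau * B2 + B3)); first exact: r_cvg0.
move=> i; apply: (le_trans (ler_normB _ _)); apply: lerD => //.
apply: (le_trans (ler_normB _ _)); rewrite normrN; apply: lerD => //.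
by rewrite normrZ gtr0_norm // ler_pM2l.
Qed.

Lemma sum_defG_ge0 i : 0 <= \sum_(m < M) omega m * defG i m.
Proof. by apply: sumr_ge0 => m _; rewrite mulr_ge0 ?defG_ge0 // ltW. Qed.

Lemma defF_cvg0 : defF i @[i --> \oo] --> 0.
Proof.
apply: (squeeze_cvgr _ (cvg_cst 0) err_cvg0); apply: nearW => i.
rewrite defF_ge0 /= -defect_sum -addrA lerDl addr_ge0 ?sum_defG_ge0 //.
by rewrite mulr_ge0 ?defC_ge0 // ltW.
Qed.

Lemma defG_cvg0 m : defG i m @[i --> \oo] --> 0.
Proof.
apply: (@cvg0_scale _ (omega m) _ err) => //; first by move=> i; exact: defG_ge0.
  move=> i; rewrite -defect_sum (bigD1 m) //=.
  have := defF_ge0 i; have := mulr_ge0 (ltW tau0) (defC_ge0 i).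
  have : 0 <= \sum_(j < M | j != m) omega j * defG i j.
    by apply: sumr_ge0 => j _; rewrite mulr_ge0 ?defG_ge0 // ltW.
  move: (\sum_(_ < _ | _) _) (tau * _) (defF i) (omega m * _) => a b c d; lra.
exact: err_cvg0.
Qed.

Lemma dC_cvg0 : inner (C (x i) - C z) (C (x i) - C z) @[i --> \oo] --> 0.
Proof.
have bt : 0 < tau / beta by rewrite divr_gt0.
apply: (@cvg0_scale _ (tau / beta) _ err) => //; first by move=> i; exact: inner_ge0.
  move=> i; apply: (le_trans (ler_wpM2l (ltW bt) (defC_ge i))).
  rewrite mulrA divfK ?gt_eqF // -defect_sum.
  have := defF_ge0 i; have := sum_defG_ge0 i; move: (tau * _) => a; lra.
exact: err_cvg0.
Qed.

(** [minty_wlim_gap] applies to [F] and to each [G m] since all defects vanish in the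
    limit.  The weighted sum of its right-hand sides is 0 because the limiting
    subgradients and those of the fixed state [t] both sum to [- tau C z]: the gradients
    converge strongly to [C z].  Cocoercivity then identifies [C z] with the value of
    [C] at the weak limit. *)
Lemma ultra_limit_fixed (U : set_system nat) : UltraFilter U -> \oo `<=` U ->
  exists (t' : 'I_M -> X) z', [/\ prox_outputs t' z' (fun=> z'),
    forall m, wlim U (fun i => s i m) (t' m) & wlim U x z'].
Proof.
move=> UU sU; have PU : ProperFilter U by exact: ultra_proper.
have ooU (a : nat -> R) (l : R) : a @ \oo --> l -> a @ U --> l.
  by move=> al V /al; apply: sU.
have bnd (a : nat -> X) b : (exists B, forall i, `|a i - b| <= B) -> exists l, wlim U a l.
  case=> B HB; apply: (bounded_wlim (B := B + `|b|)) => // i.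
  by rewrite -[a i](subrK b) (le_trans (ler_normD _ _)) // lerD2r.
have [t' st'] := choice (fun m => bnd _ _ (ds_bound m)).
have [z' xz'] := bnd _ _ dx_bound.
have CC : wlim U (fun i => C (x i)) (C z) by exact: strong_wlim (ooU _ _ dC_cvg0).
have yz' m : wlim U (fun i => y i m) z'.
  have : wlim U (fun i => x i + r i m) (z' + 0).
    apply: wlimD => //; have := ooU _ _ (r_cvg0 m).
    by under eq_cvg do rewrite -[r _ m]subr0; exact: strong_wlim.
  by rewrite addr0; congr wlim; apply/funext => i; rewrite /r addrC subrK.
have uw : wlim U (fun i => avg (s i) - x i) (avg t' - z').
  by apply: wlimB => //; apply: wlim_sum => m; apply: wlimZ.
have vw m : wlim U (fun i => 2 *: x i - s i m - tau *: C (x i) - y i m)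
    (2 *: z' - t' m - tau *: C z - z').
  by do ![apply: wlimB => //]; exact: wlimZ.
pose p := prox F (z' + (avg t' - z')).
have hp : subdiff F p (z' + (avg t' - z') - p) by exact: prox_subdiff hF ht.1.
pose q m := prox (G m) (z' + (2 *: z' - t' m - tau *: C z - z')).
have hq m : subdiff (G m) (q m) (z' + (2 *: z' - t' m - tau *: C z - z') - q m).
  exact: prox_subdiff (hG m) (ht.2 m).
have mF := minty_wlim_gap (PF := PU) hF (fun i => (hev i).1) xz' uw (ooU _ _ defF_cvg0) hp.
have mG m := minty_wlim_gap (PF := PU) (hG m) (fun i => (hev i).2 m) (yz' m) (vw m)
  (ooU _ _ (defG_cvg0 m)) (hq m).
have tot : inner (z' - p) (z' - p) + wdot (fun m => z' - q m) (fun m => z' - q m) <= 0.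
  have : wdot (fun m => z' - q m) (fun m => z' - q m) <=
     \sum_(m < M) omega m * (inner (z' - z) (t' m - t m) - inner (z' - z) (z' - z)).
    apply: ler_sum => m _; rewrite ler_pM2l //; apply: (le_trans (mG m)).
    rewrite -innerBr -innerNr le_eqVlt; apply/orP; left; apply/eqP.
    by congr (inner _ _); vector.
  under eq_bigr do rewrite mulrBr.
  rewrite sumrB omega_cst -inner_avg -avgB; move: mF.
  have -> : avg t' - z' - (avg t - z) = (avg t' - avg t) - (z' - z) by vector.
  rewrite (innerBr _ _ (z' - z)); lra.
have zp : z' = p.
  apply/eqP; rewrite -subr_eq0; apply/eqP/inner_eq0.
  by have := wdot_ge0 (fun m => z' - q m); lra.
have zq m : z' = q m.
  apply/eqP; rewrite -subr_eq0; apply/eqP/inner_eq0.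
  rewrite -(pmulr_rle0 _ (omega0 m)); apply: (le_trans (wdot_ge_term (fun m => z' - q m) m)).
  by have := inner_ge0 (z' - p); lra.
have Cz : C z = C z'.
  have H : inner (x i - z') (C (x i) - C z') @[i --> U] --> 0.
    have [B HB] := dx_bound.
    have H1 : inner (C (x i) - C z) (x i - z') @[i --> U] --> 0.
      apply: (inner_cvg0 (B := B + `|z - z'|)); first by apply: ooU; exact: dC_cvg0.
      by move=> i; rewrite -[x i](subrK z) -addrA (le_trans (ler_normD _ _)) // lerD2r.
    have xz0 : wlim U (fun i => x i - z') (z' - z') by apply: wlimB => //; exact: wlim_cst.
    have := xz0 (C z - C z'); rewrite subrr inner0l => H2.
    have E i : inner (x i - z') (C (x i) - C z') =
        inner (C (x i) - C z) (x i - z') + inner (x i - z') (C z - C z').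
      by rewrite (innerC (C (x i) - C z)) -innerDr; congr (inner _ _); vector.
    under eq_cvg do rewrite E. by have := cvgD (FF := PU : Filter U) H1 H2; rewrite addr0.
  have H2 : inner (C (x i) - C z') (C (x i) - C z') @[i --> U] --> 0.
    apply: (@squeeze_cvgr _ _ _ _ (fun=> 0) (fun i => beta * inner (x i - z') (C (x i) - C z'))).
    + by apply: nearW => i; rewrite inner_ge0 /=; exact: C_cocoercive.
    + exact: cvg_cst.
    + by rewrite -[X in _ --> X](mulr0 beta); apply: cvgMl_tmp.
  have CC' : wlim U (fun i => C (x i)) (C z') by exact: strong_wlim.
  by apply: inner_inj => w; exact: (cvg_unique _ (CC w) (CC' w)).
exists t', z'; split=> //; split.
  by move: hp; rewrite -zp; congr (subdiff _ _ _); vector.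
by move=> m; move: (hq m); rewrite -zq -Cz; congr (subdiff _ _ _); vector.
Qed.

End FixedPoint.

Lemma dist_cvg t z : prox_outputs t z (fun=> z) ->
  cvgn (fun i => wdot (fun m => s i m - t m) (fun m => s i m - t m)).
Proof.
move=> ht; apply: nonincreasing_is_cvgn.
  by apply/nonincreasing_seqP => i; exact: dist_decr ht i.
by exists 0 => _ [i _ <-]; exact: wdot_ge0.
Qed.

(** The difference of the squared distances to [t1] and [t2] is affine in [s i] with
    direction [t1 - t2]; since it converges, [wdot (s i) (t1 - t2)] has the same limit
    along both filters. *)
Lemma opial_unique (U1 U2 : set_system nat) {P1 : ProperFilter U1} {P2 : ProperFilter U2}
  t1 z1 t2 z2 : \oo `<=` U1 -> \oo `<=` U2 ->
  prox_outputs t1 z1 (fun=> z1) -> prox_outputs t2 z2 (fun=> z2) ->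
  (forall m, wlim U1 (fun i => s i m) (t1 m)) ->
  (forall m, wlim U2 (fun i => s i m) (t2 m)) -> z1 = z2.
Proof.
move=> sU1 sU2 h1 h2 w1 w2.
pose e m := t1 m - t2 m.
have E i : wdot (s i) e = 2^-1 * (wdot (fun m => s i m - t2 m) (fun m => s i m - t2 m) -
    wdot (fun m => s i m - t1 m) (fun m => s i m - t1 m) + (wdot t1 t1 - wdot t2 t2)).
  rewrite /wdot -!sumrB -big_split mulr_sumr; apply: eq_bigr => m _; rewrite /e /=.
  move: (s i m) (t1 m) (t2 m) => a b c.
  by rewrite !innerE (innerC b a) (innerC c a); field.
have [l Hl] : exists l : R, wdot (s i) e @[i --> \oo] --> l.
  have /cvg_ex[/= l1 H1] := dist_cvg h1; have /cvg_ex[/= l2 H2] := dist_cvg h2.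
  exists (2^-1 * (l2 - l1 + (wdot t1 t1 - wdot t2 t2))); under eq_cvg do rewrite E.
  by apply: cvgMl_tmp; apply: cvgD; [exact: cvgB | exact: cvg_cst].
have lim (U : set_system nat) (PU : ProperFilter U) (t : 'I_M -> X) :
    \oo `<=` U -> (forall m, wlim U (fun i => s i m) (t m)) -> wdot t e = l.
  move=> sU w; have H : wdot (s i) e @[i --> U] --> l by move=> V /Hl; apply: sU.
  suff H' : wdot (s i) e @[i --> U] --> wdot t e by exact: (cvg_unique _ H' H).
  apply: cvg_big; first exact: add_continuous.
  by move=> m _; apply: cvgMl_tmp; exact: w.
have e0 : wdot e e = 0.
  have -> : wdot e e = wdot t1 e - wdot t2 e.
    by rewrite /wdot -sumrB; apply: eq_bigr => m _; rewrite -mulrBr -innerBl.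
  by rewrite (lim U1 P1 t1 sU1 w1) (lim U2 P2 t2 sU2 w2) subrr.
have := proxF_nonexpansive h1 h2; rewrite -/e e0 => /inner_eq0/eqP.
by rewrite subr_eq0 => /eqP.
Qed.

Theorem splitting_weakly_cvg t z : prox_outputs t z (fun=> z) ->
  exists t' z', prox_outputs t' z' (fun=> z') /\ weakly_cvg x z'.
Proof.
move=> ht.
have [U [UU sU]] := ultraFilterLemma (@eventually_filter).
have [t' [z' [h' w' xw']]] := ultra_limit_fixed ht UU sU.
exists t', z'; split=> // v; apply: cvg_ultra => U' UU' sU'.
have [t2 [z2 [h2 w2 xw2]]] := ultra_limit_fixed ht UU' sU'.
have PU : ProperFilter U by exact: ultra_proper.
have PU' : ProperFilter U' by exact: ultra_proper.
by rewrite (opial_unique sU sU' h' h2 w' w2); exact: xw2.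
Qed.

End Iteration.
End Splitting.


(** * Back to the minimization problem *)

Lemma argmin_sum {R : realType} {X : hilbertType R} (M : nat) (f : X -> \bar R)
  (g : 'I_M -> X -> \bar R) (h : X -> R) x u (v : 'I_M -> X) w :
  subdiff f x u -> (forall m, subdiff (g m) x (v m)) ->
  (forall y, h x + inner w (y - x) <= h y) ->
  u + \sum_(m < M) v m + w = 0 ->
  argmin (fun y => f y + \sum_(m < M) g m y + (h y)%:E)%E x.
Proof.
move=> hu hv hw sum0 y.
have := leeD (leeD (hu y) (lee_sum (index_enum _) (fun m _ => hv m y)))
  (_ : ((h x + inner w (y - x))%:E <= (h y)%:E)%E).
rewrite lee_fin => /(_ xpredT (hw y)) /=; apply: le_trans.
rewrite big_split /= sumEFin -inner_suml EFinD.
rewrite (addeACA (f x)) (addeACA (f x + _)%E) -!EFinD -!innerDl sum0 inner0l adde0.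
exact: lexx.
Qed.

(** The functions are rescaled so that each step is an unscaled prox.  The state [t0]
    built from the assumed solution is the one at which the optimality conditions of
    the proximal evaluations hold with the given subgradients. *)
Theorem theorem9p8 (R : realType) (X : hilbertType R) (M : nat) (hM : (1 <= M)%N)
  (f : X -> \bar R) (g : 'I_M -> X -> \bar R) (h : X -> R) (beta : R)
  (hf : Gamma0 f) (hg : forall m, Gamma0 (g m))
  (hconv : convex_function [set: convex_lmodType X] h)
  (hdiff : forall x : X, differentiable h x)
  (hbeta : 0 < beta) (hlip : beta.-lipschitz (grad h))
  (hsol : exists (x u : X) (v : 'I_M -> X),
     [/\ subdiff f x u, forall m, subdiff (g m) x (v m)
       & 0 = u + \sum_(m < M) v m + grad h x])
  (s0 : 'I_M -> X) (tau : R) (htau : 0 < tau < 2 / beta)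
  (omega : 'I_M -> R) (homega : forall m, 0 < omega m)
  (homega1 : \sum_(m < M) omega m = 1)
  (delta : R) (hdelta : delta = 2 - tau * beta / 2)
  (rho : nat -> R) (hrho : forall i, 0 <= rho i <= delta)
  (hsum : (\sum_(0 <= i <oo) (rho i * (delta - rho i))%:E = +oo)%E)
  (xh : nat -> X) (s : nat -> 'I_M -> X)
  (hs0 : forall m, s 0%N m = s0 m)
  (hxh : forall i,
     xh i = prox (fun y => tau%:E * f y)%E (\sum_(m < M) omega m *: s i m))
  (hs : forall i m,
     s i.+1 m = s i m + rho i *:
       (prox (fun y => (tau / omega m)%:E * g m y)%E
          (2 *: xh i - s i m - tau *: grad h (xh i)) - xh i)) :
  exists x : X,
    argmin (fun y => f y + \sum_(m < M) g m y + (h y)%:E)%E x /\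
    weakly_cvg xh x.
Proof.
have [x0 [u0 [v0 [hu0 hv0 sum0]]]] := hsol.
have /andP[tau0 taub] := htau.
have tom m : 0 < tau / omega m by rewrite divr_gt0.
pose F y : \bar R := (tau%:E * f y)%E.
pose G m y : \bar R := ((tau / omega m)%:E * g m y)%E.
have hF : Gamma0 F by exact: Gamma0_scale.
have hG m : Gamma0 (G m) by exact: Gamma0_scale.
have C_cocoercive := cocoercive hconv hdiff hbeta hlip.
have tb2 : tau * beta < 2 by rewrite -ltr_pdivlMr.
have delta_gt0 : 0 < 2 - tau * beta / 2 by lra.
have hu1 : subdiff F x0 (tau *: u0) by exact: (subdiff_scale _ _ _ tau0).1.
have hv1 m : subdiff (G m) x0 ((tau / omega m) *: v0 m) by exact: (subdiff_scale _ _ _ (tom m)).1.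
pose y i m := prox (G m) (2 *: xh i - s i m - tau *: grad h (xh i)).
pose t0 m := x0 - tau *: grad h x0 - (tau / omega m) *: v0 m.
have cst (c : X) : avg omega (fun=> c) = c by rewrite /avg -scaler_suml homega1 scale1r.
have rescale (w : 'I_M -> X) :
    avg omega (fun m => (tau / omega m) *: w m) = tau *: \sum_(m < M) w m.
  rewrite /avg scaler_sumr; apply: eq_bigr => m _.
  by rewrite scalerA mulrC divfK // gt_eqF.
have ev0 : prox_outputs F G (grad h) tau omega t0 x0 (fun=> x0).
  split; last by move=> m; have := hv1 m; congr (subdiff _ _ _); rewrite /t0; vector.
  have -> : avg omega t0 - x0 = tau *: u0; last by [].
  rewrite /t0 -avgB cst rescale.
  have -> : \sum_(m < M) v0 m = - u0 - grad h x0.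
    by move: sum0; move: (\sum_(m < M) v0 m) => V e0; rewrite -[LHS]subr0 e0; vector.
  by vector.
have ev i : prox_outputs F G (grad h) tau omega (s i) (xh i) (y i).
  by split; [rewrite hxh; exact: prox_subdiff hF hu1 |
    move=> m; exact: prox_subdiff (hG m) (hv1 m)].
rewrite hdelta in hrho hsum.
have [t [x [evt cvx]]] := splitting_weakly_cvg hF hG hbeta tau0 C_cocoercive homega homega1 delta_gt0
  (grad_lip hlip) hrho hsum ev hs ev0.
exists x; split=> //.
apply: (@argmin_sum _ _ _ _ _ _ _ (tau^-1 *: (avg omega t - x))
  (fun m => (omega m / tau) *: (2 *: x - t m - tau *: grad h x - x)) (grad h x)).
- apply/(subdiff_scale _ _ _ tau0); rewrite scalerA divff ?gt_eqF // scale1r; exact: evt.1.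
- move=> m; apply/(subdiff_scale _ _ _ (tom m)); rewrite scalerA.
  rewrite (_ : tau / omega m * (omega m / tau) = 1) ?scale1r; first exact: evt.2.
  by field; rewrite !gt_eqF.
- exact: grad_subgradient.
- have -> : \sum_(m < M) (omega m / tau) *: (2 *: x - t m - tau *: grad h x - x) =
      tau^-1 *: (x - tau *: grad h x - avg omega t).
    rewrite -[x - tau *: grad h x]cst avgB /avg scaler_sumr; apply: eq_bigr => m _.
    by rewrite scalerA (mulrC tau^-1); congr (_ *: _); vector.
  rewrite -scalerDr.
  have -> : avg omega t - x + (x - tau *: grad h x - avg omega t) = - tau *: grad h x by vector.
  by rewrite scalerA mulrN mulVf ?gt_eqF // scaleN1r addNr.
Qed.
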